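(* Let $A,B\subseteq S\subseteq V$ with $A\cap B=\emptyset$. Then $Y_A$ is Granger non-causal for $Y_B$ with respect to $Y_S$ if and only if for all $h\in[0,1]$, $t\in\mathbb{R}$ and $b\in B$, $$P_{\mathcal{L}_{Y_S}(t)}Y_b(t+h)=P_{\mathcal{L}_{Y_{S\setminus A}}(t)}Y_b(t+h)\quad \mathbb{P}\text{-a.s.}$$
   Context: $V=\{1,\ldots,k\}$ and $Y_V=(Y_V(t))_{t\in\mathbb{R}}$ is a $k$-dimensional weakly stationary stochastic process with expectation zero that is continuous in mean square, with components $Y_v=(Y_v(t))_{t\in\mathbb R}$, $v\in V$, and subprocesses $Y_A=(Y_a)_{a\in A}$ for $A\subseteq V$. $L^2=L^2(\Omega,\mathcal F,\mathbb P)$ is the Hilbert space of square-integrable complex-valued random variables with $\langle X,Y\rangle=\mathbb{E}[X\overline{Y}]$ (a.s. equal variables identified). $P_{\mathcal L}$ is the orthogonal projection onto a closed linear subspace $\mathcal L$. For $A\subseteq V$ and $-\infty\le s\le t\le\infty$, $\mathcal{L}_{Y_A}(s,t)$ is the closed linear span in $L^2$ of $\{Y_a(u):a\in A,\ u\in[s,t]\cap\mathbb{R}\}$, and $\mathcal{L}_{Y_A}(t)=\mathcal{L}_{Y_A}(-\infty,t)$ (equal to $\{0\}$ if $A=\emptyset$). Closed subspaces $\mathcal{L}_1,\mathcal{L}_2$ are conditionally orthogonal given the closed subspace $\mathcal{L}_3$, written $\mathcal{L}_1\perp\mathcal{L}_2\mid\mathcal{L}_3$, if $\mathbb{E}[(X-P_{\mathcal{L}_3}X)\overline{(Y-P_{\mathcal{L}_3}Y)}]=0$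 for all $X\in\mathcal{L}_1$, $Y\in\mathcal{L}_2$. For $A,B\subseteq S\subseteq V$, $A\cap B=\emptyset$, $Y_A$ is Granger non-causal for $Y_B$ with respect to $Y_S$ if $\mathcal{L}_{Y_B}(t,t+1)\perp\mathcal{L}_{Y_A}(t)\mid\mathcal{L}_{Y_{S\setminus A}}(t)$ for all $t\in\mathbb{R}$. *)

(* Defs.v *)
From mathcomp Require Import all_boot all_order all_algebra.
From mathcomp Require Import all_classical all_reals all_analysis.
From mathcomp.real_closed Require Import complex.
Import Order.TTheory GRing.Theory Num.Theory.
Import numFieldNormedType.Exports.

Set Implicit Arguments.
Unset Strict Implicit.
Unset Printing Implicit Defensive.

Local Open Scope classical_set_scope.
Local Open Scope ring_scope.
Local Open Scope complex_scope.

(* Elements of L^2 are represented by functions; the closed subspaces below are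
   sets of representatives, saturated for almost sure equality. *)
Section ComplexL2.
Context (d : measure_display) (T : measurableType d) (R : realType).
Variable P : probability T R.
Implicit Types (X Y Z : T -> R[i]) (L G : set (T -> R[i])).

Definition sqmod (z : R[i]) : R := complex.Re z ^+ 2 + complex.Im z ^+ 2.

(* E|X|^2, possibly infinite *)
Definition mean_square X : \bar R := 'E_P[fun w => sqmod (X w)].

Definition L2 : set (T -> R[i]) :=
  [set X | [/\ measurable_fun setT (fun w => complex.Re (X w)),
               measurable_fun setT (fun w => complex.Im (X w)) &
               (mean_square X < +oo)%E]].

Definition cexpectation X : R[i] :=
  fine 'E_P[fun w => complex.Re (X w)] +i* fine 'E_P[fun w => complex.Im (X w)].

Definition inner X Y : R[i] := cexpectation (fun w => X w * (Y w)^*).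

Definition ccovariance X Y : R[i] :=
  inner (fun w => X w - cexpectation X) (fun w => Y w - cexpectation Y).

Definition linear_span G : set (T -> R[i]) :=
  [set X | exists (n : nat) (c : 'I_n -> R[i]) (f : 'I_n -> T -> R[i]),
     (forall i, G (f i)) /\ X = (fun w => \sum_(i < n) c i * f i w)].

Definition closed_span G : set (T -> R[i]) :=
  [set X | L2 X /\ forall e : R, 0 < e ->
     exists2 Z, linear_span G Z & (mean_square (X \- Z)%R < e%:E)%E].

(* A representative of the orthogonal projection of X onto L, which exists and
   is a.s. unique when X is in L^2 and L is a closed subspace; the default value
   is only taken outside that situation. *)
Definition is_projection L X Z : Prop :=
  L Z /\ forall W, L W -> inner (X \- Z) W = 0.

Definition orth_proj L X : T -> R[i] := xget (fun=> 0) (is_projection L X).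

Definition cond_orthogonal L1 L2 L3 : Prop :=
  forall X Y, L1 X -> L2 Y -> inner (X \- orth_proj L3 X) (Y \- orth_proj L3 Y) = 0.

End ComplexL2.

Section Processes.
Context (d : measure_display) (T : measurableType d) (R : realType).
Variables (P : probability T R) (k : nat).

Definition process := 'I_k -> R -> T -> R[i].

Implicit Types (Y : process) (A B S : {set 'I_k}).

Definition weakly_stationary Y : Prop :=
  [/\ forall v t, L2 P (Y v t),
      forall v s t, cexpectation P (Y v s) = cexpectation P (Y v t) &
      forall u v s t h, ccovariance P (Y u (s + h)) (Y v (t + h)) =
                        ccovariance P (Y u s) (Y v t)].

Definition centered Y : Prop := forall v t, cexpectation P (Y v t) = 0.

Definition mean_square_continuous Y : Prop :=
  forall v t, mean_square P (Y v s \- Y v t) @[s --> t] --> 0%E.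

Definition process_space Y A (s t : \bar R) : set (T -> R[i]) :=
  closed_span P [set X | exists a u,
    [/\ a \in A, (s <= u%:E <= t)%E & X = Y a u]].

Definition past_space Y A (t : R) : set (T -> R[i]) :=
  process_space Y A -oo%E t%:E.

Definition granger_noncausal Y A B S : Prop :=
  forall t : R,
    cond_orthogonal P (process_space Y B t%:E (t + 1)%:E) (past_space Y A t)
      (past_space Y (S :\: A)%SET t).

End Processes.

(* Main.v *)
Require Import Defs.
From mathcomp Require Import all_boot all_order all_algebra.
From mathcomp Require Import all_classical all_reals all_analysis.
From mathcomp.real_closed Require Import complex.
From mathcomp Require Import measurable_realfun.
From mathcomp Require Import ring lra.
Import Order.TTheory GRing.Theory Num.Theory.
Import numFieldNormedType.Exports.
Local Open Scope classical_set_scope.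
Local Open Scope ring_scope.

Set Implicit Arguments.
Unset Strict Implicit.
Unset Printing Implicit Defensive.

(** Let [C = S :\: A], and for [b] in [B] and [u] in [[t, t + 1]] let [r] be the
residual of [Y b u] after projection onto the past of [Y_C]. Granger
non-causality says that [r] is orthogonal to the residuals of the variables in
the past of [Y_A]. Since [r] is orthogonal to the past of [Y_C], this amounts to
orthogonality to the past of [Y_A] itself, and, as the pasts of [Y_A] and [Y_C]
together generate the past of [Y_S], to orthogonality of [r] to the past of
[Y_S]. In other words, the projection of [Y b u] onto the past of [Y_C] is also
its projection onto the past of [Y_S]. Conversely, when the two projections
agree for all the [Y b u], the orthogonality extends to the closed span of these
variables by linearity and continuity of the inner product. This is
[cond_orthogonal_closed_spanP], stated for closed spans of arbitrary sets of
square-integrable variables.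

Residuals make sense only if projections exist ([projection_theorem]), that is,
if the space of square-integrable variables is complete. A sequence whose
increments decrease geometrically in mean square has almost surely absolutely
summable increments, thus an almost sure limit, and Fatou's lemma shows that it
is also the limit in mean square ([fast_cauchy_real_L2], [L2_complete]). The
projection is then the limit of a minimizing sequence, by the parallelogram law;
it is unique up to almost sure equality ([projection_ae_unique]). *)

(** * Completeness of the real square-integrable functions *)

Section RealCompleteness.
Context (d : measure_display) (T : measurableType d) (R : realType).
Variable P : probability T R.

(** The inequality [x <= s^-1 + s * x ^+ 2] integrated. With [s = 2 ^ n] it turns
a mean square of order [4 ^ - n] into a first absolute moment of order
[2 ^ - n], which is summable. *)
Lemma integral_norm_le_mean_square (f : T -> R) (s : R) : 0 < s ->
  measurable_fun setT f ->
  (\int[P]_w `|f w|%:E <=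
     s^-1%:E + s%:E * 'E_P[fun w => (f w ^+ 2)%R])%E.
Proof.
move=> s0 mf.
have mf2 : measurable_fun setT (fun w => (f w ^+ 2)%:E : \bar R).
  by apply/measurable_EFinP; exact: measurable_funX.
rewrite -[X in (X%:E + _)%E]mulr1 EFinM -(probability_setT P) unlock.
rewrite -integral_cst// -ge0_integralZl//; first last.
- by rewrite lee_fin ltW.
- by move=> w _; rewrite lee_fin sqr_ge0.
rewrite -ge0_integralD//=; first last.
- exact: measurable_funeM.
- by move=> w _; rewrite -EFinM lee_fin mulr_ge0 ?sqr_ge0 ?ltW.
- by move=> w _; rewrite lee_fin invr_ge0 ltW.
apply: ge0_le_integral => //=.
- by apply/measurable_EFinP; exact: measurableT_comp.
- by apply: emeasurable_funD => //; exact: measurable_funeM.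
move=> w _; rewrite -EFinM -EFinD lee_fin -(real_normK (num_real (f w))).
move: `|f w| => x; rewrite -subr_ge0.
rewrite (_ : _ - x = s^-1 * ((s * x - 2^-1) ^+ 2 + 3 / 4)).
  by rewrite mulr_ge0 ?invr_ge0 ?(ltW s0)// addr_ge0 ?sqr_ge0.
by field; rewrite gt_eqF.
Qed.

(** The increments have summable first absolute moments, so that the sum [G] of
their absolute values is integrable, hence finite almost surely, and [f n w]
converges for almost every [w]. Fatou's lemma transfers the bound on
[f m - f n] to the limit in [m]. *)
Lemma fast_cauchy_real_L2 (f : nat -> T -> R) :
  (forall n, measurable_fun setT (f n)) ->
  (forall n m, (n <= m)%N ->
     ('E_P[fun w => ((f m w - f n w) ^+ 2)%R] <= (4^-1 ^+ n)%:E)%E) ->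
  exists g : T -> R, measurable_fun setT g /\
    forall n, ('E_P[fun w => ((g w - f n w) ^+ 2)%R] <= (4^-1 ^+ n)%:E)%E.
Proof.
move=> mf Hf.
pose D n w : \bar R := `|f n.+1 w - f n w|%:E.
have mD n : measurable_fun setT (D n).
  apply/measurable_EFinP; apply: measurableT_comp => //.
  exact: measurable_funB.
have D0 n w : (0 <= D n w)%E by rewrite lee_fin.
(* The bound is written as the summand of [epsilon_trick0], whose sum is 4. *)
have intD n : (\int[P]_w D n w <= (4 / (2 ^ n.+1)%:R)%:E)%E.
  have p0 : 0 < 2 ^+ n :> R by rewrite exprn_gt0.
  apply: (le_trans (@integral_norm_le_mean_square
    (fun w => f n.+1 w - f n w) _ p0 _)).
    exact: measurable_funB.
  apply: (@le_trans _ _ ((2 ^+ n)^-1%:E + (2 ^+ n)%:E * (4^-1 ^+ n)%:E)%E).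
    by rewrite leeD2l// lee_pmul2l//; exact: Hf.
  rewrite -EFinM -EFinD lee_fin natrX exprS.
  rewrite (_ : 4^-1 = 2^-1 * 2^-1); last by field.
  rewrite exprMn exprVn le_eqVlt; apply/orP; left; apply/eqP.
  by field; rewrite ?expf_neq0.
pose G w := (\sum_(n <oo) D n w)%E.
have mG : measurable_fun setT G by exact: ge0_emeasurable_sum.
have intG : (\int[P]_w G w < +oo)%E.
  rewrite integral_nneseries//.
  apply: (@le_lt_trans _ _ 4%:E); last by rewrite ltry.
  apply: le_trans; last exact: (@epsilon_trick0 R 4 xpredT).
  by apply: lee_nneseries => // n _ _; exact: integral_ge0.
have G0 w : (0 <= G w)%E by exact: nneseries_ge0.
have Gae : {ae P, forall w, (G w < +oo)%E}.
  have /integrable_ae : P.-integrable setT G.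
    apply/integrableP; split => //.
    by under eq_integral => w _ do rewrite gee0_abs//.
  by move=> /(_ measurableT); apply: filterS => w /(_ I); rewrite ge0_fin_numE.
pose A := [set w | (G w < +oo)%E].
have mA : measurable A.
  by rewrite -[A]setTI; apply: emeasurable_fun_infty_o.
have cvA w : A w -> cvgn (f ^~ w).
  move=> Aw; have : cvgn (series (telescope (f ^~ w))).
    apply: normed_cvg.
    by apply: (@nnseries_is_cvg _ (fun n => `|f n.+1 w - f n w|)).
  rewrite telescopeK => cvf.
  rewrite (_ : f ^~ w = (fun n => f n w - f 0%N w) \+ cst (f 0%N w)).
    exact: is_cvgD cvf (is_cvg_cst _).
  by apply/funext => n /=; rewrite subrK.
(* Killing the sequence outside [A] makes it converge everywhere, so that its
   limit is measurable and no limit inferior remains after Fatou's lemma. *)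
pose h n w := f n w * \1_A w.
have mh n : measurable_fun setT (h n).
  by apply: measurable_funM => //; exact: measurable_indic.
have cvh w : cvgn (h ^~ w).
  rewrite /h indicE; case: (boolP (w \in A)) => [|_].
    rewrite inE => /cvA; rewrite (_ : (fun x => _) = f ^~ w)//.
    by apply/funext => n; rewrite mulr1.
  rewrite (_ : (fun x => _) = fun=> 0); first exact: is_cvg_cst.
  by apply/funext => n; rewrite mulr0.
pose g w := limn (h ^~ w).
have mg : measurable_fun setT g.
  by apply: (@measurable_fun_cvg _ _ _ _ h) => // w _; exact: cvh.
exists g; split => // n.
pose u m w := ((h (m + n)%N w - h n w) ^+ 2)%:E.
have mu m : measurable_fun setT (u m).
  by apply/measurable_EFinP; apply: measurable_funX; exact: measurable_funB.
have u0 m w : (0 <= u m w)%E by rewrite lee_fin sqr_ge0.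
have uE w : limn_einf (u ^~ w) = ((g w - h n w) ^+ 2)%:E.
  have uw : u ^~ w @ \oo --> ((g w - h n w) ^+ 2)%:E.
    apply: cvg_EFin; first by near=> m.
    have hw : (fun m => h (m + n)%N w - h n w) @ \oo --> g w - h n w.
      apply: cvgB; last exact: cvg_cst.
      by rewrite (cvg_shiftn n (h ^~ w)); exact: cvh.
    exact: (cvgM hw hw).
  by rewrite is_cvg_limn_einfE ?(cvg_lim _ uw)//.
have -> : ('E_P[fun w => ((g w - f n w) ^+ 2)%R] =
           \int[P]_w limn_einf (u ^~ w))%E.
  under [RHS]eq_integral do rewrite uE.
  rewrite unlock; apply: ge0_ae_eq_integral => //.
  - by apply/measurable_EFinP; apply: measurable_funX; exact: measurable_funB.
  - by apply/measurable_EFinP; apply: measurable_funX; exact: measurable_funB.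
  - by move=> w _; rewrite lee_fin sqr_ge0.
  - by move=> w _; rewrite lee_fin sqr_ge0.
  apply: filterS Gae => w Gw _.
  by rewrite /h indicE mem_set ?mulr1.
apply: le_trans (fatou _ _ _ _) _ => //.
rewrite limn_einf_lim; apply: lime_le; first exact: is_cvg_einfs.
near=> m.
apply: (@le_trans _ _ (\int[P]_w u m w)%E).
  by apply: ereal_inf_lbound; exists m => /=.
apply: le_trans (Hf n (m + n)%N (leq_addl _ _)).
rewrite unlock; apply: ge0_le_integral => //.
- by apply/measurable_EFinP; apply: measurable_funX; exact: measurable_funB.
- move=> w _; rewrite lee_fin /h -mulrBl exprMn indicE.
  by case: (_ \in _); rewrite ?expr1n ?mulr1// expr0n mulr0 sqr_ge0.
Unshelve. all: end_near.
Qed.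
End RealCompleteness.

(** * Complex numbers by components *)

Section ComplexParts.
Context (R : realType).
Implicit Types z w : R[i].

Lemma complex_ext z w :
  complex.Re z = complex.Re w -> complex.Im z = complex.Im w -> z = w.
Proof. by case: z w => [a b] [c e] /= -> ->. Qed.

Lemma ReD z w : complex.Re (z + w) = complex.Re z + complex.Re w.
Proof. by case: z; case: w. Qed.
Lemma ImD z w : complex.Im (z + w) = complex.Im z + complex.Im w.
Proof. by case: z; case: w. Qed.
Lemma ReN z : complex.Re (- z) = - complex.Re z.
Proof. by case: z. Qed.
Lemma ImN z : complex.Im (- z) = - complex.Im z.
Proof. by case: z. Qed.
Lemma ReM z w : complex.Re (z * w) =
  complex.Re z * complex.Re w - complex.Im z * complex.Im w.
Proof. by case: z; case: w. Qed.
Lemma ImM z w : complex.Im (z * w) =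
  complex.Re z * complex.Im w + complex.Im z * complex.Re w.
Proof. by case: z; case: w. Qed.
Lemma Re_conj z : complex.Re (Num.conj z) = complex.Re z.
Proof. by case: z. Qed.
Lemma Im_conj z : complex.Im (Num.conj z) = - complex.Im z.
Proof. by case: z. Qed.
Definition componentE := (ReD, ImD, ReN, ImN, ReM, ImM, Re_conj, Im_conj).

Lemma sqmod_ge0 z : 0 <= sqmod z.
Proof. by rewrite addr_ge0// sqr_ge0. Qed.

Lemma sqmod_eq0 z : sqmod z = 0 -> z = 0.
Proof.
move/eqP; rewrite paddr_eq0 ?sqr_ge0// !sqrf_eq0 => /andP[/eqP r0 /eqP i0].
exact: complex_ext.
Qed.

Lemma sqmodM z w : sqmod (z * w) = sqmod z * sqmod w.
Proof. by rewrite /sqmod !componentE; ring. Qed.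

Lemma sqmodD_le z w : sqmod (z + w) <= 2 * (sqmod z + sqmod w).
Proof.
rewrite -subr_ge0 (_ : _ - _ = sqmod (z - w)) ?sqmod_ge0//.
by rewrite /sqmod !componentE; ring.
Qed.
End ComplexParts.

(** * The sesquilinear form on complex square-integrable variables *)

Section Hilbert.
Context (d : measure_display) (T : measurableType d) (R : realType).
Variable P : probability T R.
Implicit Types (f g : T -> R) (X Y Z U V W : T -> R[i]) (a : R[i]).
Implicit Types (L G K : set (T -> R[i])).

Local Notation rexp f := (fine 'E_P[f]).

Lemma LfunZ p c f : (1 <= p)%E -> f \in Lfun P p ->
  (fun w => c * f w) \in Lfun P p.
Proof.
move=> p1 Lf; have [L0 LL] := Lfun_submod_closed P p1.
by have := LL c _ _ Lf L0; rewrite addr0.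
Qed.

Lemma LfunD p f g : (1 <= p)%E -> f \in Lfun P p -> g \in Lfun P p ->
  (fun w => f w + g w) \in Lfun P p.
Proof.
move=> p1 Lf Lg; have [L0 LL] := Lfun_submod_closed P p1.
by have := LL 1 _ _ Lf Lg; rewrite scale1r.
Qed.

Lemma rexpD f g : f \in Lfun P 1 -> g \in Lfun P 1 ->
  rexp (fun w => f w + g w) = rexp f + rexp g.
Proof.
move=> Lf Lg; rewrite (expectationD Lf Lg) fineD//;
  exact: expectation_fin_num.
Qed.

Lemma rexpZ c f : f \in Lfun P 1 -> rexp (fun w => c * f w) = c * rexp f.
Proof.
move=> Lf; have := expectationZl c Lf.
rewrite (_ : _ \o* f = (fun w => c * f w)) => [->|].
  by rewrite fineM//; exact: expectation_fin_num.
by apply/funext => w /=; rewrite mulrC.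
Qed.

Lemma Lfun2P f : f \in Lfun P 2%:E <->
  measurable_fun setT f /\ ('E_P[fun w => (f w ^+ 2)%R] < +oo)%E.
Proof.
split=> [Lf|[mf f2]].
  split; first by move: Lf; rewrite inE => /andP[/[!inE]].
  have /integrableP[_] := Lfun2_integrable_sqr Lf.
  rewrite unlock; apply: le_lt_trans; rewrite le_eqVlt; apply/orP; left.
  by apply/eqP/eq_integral => w _; rewrite gee0_abs// lee_fin sqr_ge0.
rewrite inE; apply/andP; split; rewrite inE//= /finite_norm unlock poweR_lty//.
move: f2; rewrite unlock; apply: le_lt_trans.
rewrite le_eqVlt; apply/orP; left; apply/eqP/eq_integral => w _ /=.
by rewrite powR_mulrn// real_normK ?num_real.
Qed.

Local Notation RE X := (fun w => complex.Re (X w)).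
Local Notation IM X := (fun w => complex.Im (X w)).

Lemma mean_squareE X :
  measurable_fun setT (RE X) -> measurable_fun setT (IM X) ->
  mean_square P X =
  ('E_P[fun w => (complex.Re (X w) ^+ 2)%R] +
   'E_P[fun w => (complex.Im (X w) ^+ 2)%R])%E.
Proof.
move=> mr mi; rewrite /mean_square /sqmod unlock -ge0_integralD//.
- by move=> w _; rewrite lee_fin sqr_ge0.
- by apply/measurable_EFinP; exact: measurable_funX.
- by move=> w _; rewrite lee_fin sqr_ge0.
- by apply/measurable_EFinP; exact: measurable_funX.
Qed.

Lemma L2P X : L2 P X <-> RE X \in Lfun P 2%:E /\ IM X \in Lfun P 2%:E.
Proof.
have e0 f : (0 <= 'E_P[fun w => (f w ^+ 2)%R])%E.
  by apply: expectation_ge0 => w; exact: sqr_ge0.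
split=> [[mr mi]|[/Lfun2P[mr r2] /Lfun2P[mi i2]]].
  rewrite mean_squareE// => X2; split; apply/Lfun2P; split => //.
    by apply: le_lt_trans X2; rewrite leeDl.
  by apply: le_lt_trans X2; rewrite leeDr.
by split => //; rewrite mean_squareE// lte_add_pinfty.
Qed.

Lemma L2_0 : L2 P 0.
Proof.
by apply/L2P; split; rewrite -[X in X \in _]/(0 : T -> R);
  exact: (Lfun_submod_closed P (lee1n 2)).1.
Qed.

Lemma L2D X Y : L2 P X -> L2 P Y -> L2 P (X + Y).
Proof.
move=> /L2P[rX iX] /L2P[rY iY]; apply/L2P; split.
  rewrite (_ : RE _ = fun w => complex.Re (X w) + complex.Re (Y w)).
    exact: LfunD (lee1n 2) _ _.
  by apply/funext => w; rewrite ReD.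
rewrite (_ : IM _ = fun w => complex.Im (X w) + complex.Im (Y w)).
  exact: LfunD (lee1n 2) _ _.
by apply/funext => w; rewrite ImD.
Qed.

Lemma L2Z a X : L2 P X -> L2 P (a *: X).
Proof.
move=> /L2P[rX iX]; apply/L2P; split.
  rewrite (_ : RE _ = fun w => complex.Re a * complex.Re (X w) +
      - complex.Im a * complex.Im (X w)).
    by apply: LfunD (lee1n 2) _ _; exact: LfunZ (lee1n 2) _.
  by apply/funext => w; rewrite ReM mulNr.
rewrite (_ : IM _ = fun w => complex.Re a * complex.Im (X w) +
      complex.Im a * complex.Re (X w)).
  by apply: LfunD (lee1n 2) _ _; exact: LfunZ (lee1n 2) _.
by apply/funext => w; rewrite ImM.
Qed.

Lemma L2B X Y : L2 P X -> L2 P Y -> L2 P (X - Y).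
Proof. by move=> LX LY; rewrite -scaleN1r; exact/L2D/L2Z. Qed.

Lemma inner_Lfun1 X Y : L2 P X -> L2 P Y ->
  RE (fun w => X w * Num.conj (Y w)) \in Lfun P 1 /\
  IM (fun w => X w * Num.conj (Y w)) \in Lfun P 1.
Proof.
move=> /L2P[rX iX] /L2P[rY iY]; split.
  rewrite (_ : (fun w => _) =
      fun w => (RE X \* RE Y) w + (IM X \* IM Y) w).
    by apply: LfunD => //; exact: Lfun2_mul_Lfun1.
  by apply/funext => w /=; rewrite !componentE; ring.
rewrite (_ : (fun w => _) =
    fun w => (IM X \* RE Y) w + -1 * (RE X \* IM Y) w).
  by apply: LfunD => //; [|apply: LfunZ => //]; exact: Lfun2_mul_Lfun1.
by apply/funext => w /=; rewrite !componentE; ring.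
Qed.

Lemma innerDl X Y Z : L2 P X -> L2 P Y -> L2 P Z ->
  inner P (X + Y) Z = inner P X Z + inner P Y Z.
Proof.
move=> LX LY LZ.
have [r1 i1] := inner_Lfun1 LX LZ; have [r2 i2] := inner_Lfun1 LY LZ.
apply: complex_ext; rewrite ?ReD ?ImD /= -rexpD//;
  congr (fine (expectation P _)); apply/funext => w;
  by rewrite -?ReD -?ImD -mulrDl.
Qed.

Lemma innerZl a X Y : L2 P X -> L2 P Y -> inner P (a *: X) Y = a * inner P X Y.
Proof.
move=> LX LY; have [r1 i1] := inner_Lfun1 LX LY.
have cL c f : f \in Lfun P 1 -> (fun w => c * f w) \in Lfun P 1.
  exact: LfunZ.
apply: complex_ext.
  rewrite ReM /= -[_ - _]/(_ + _) -mulNr -!rexpZ// -rexpD//; [|exact: cL..].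
  congr (fine (expectation P _)); apply/funext => w.
  by rewrite !componentE; ring.
rewrite ImM /= -!rexpZ// -rexpD//; [|exact: cL..].
congr (fine (expectation P _)); apply/funext => w.
by rewrite !componentE; ring.
Qed.

Lemma inner_conj X Y : L2 P X -> L2 P Y ->
  inner P X Y = Num.conj (inner P Y X).
Proof.
move=> LX LY; have [r1 i1] := inner_Lfun1 LY LX.
apply: complex_ext; rewrite ?Re_conj ?Im_conj /=.
  congr (fine (expectation P _)); apply/funext => w.
  by rewrite !componentE; ring.
rewrite -mulN1r -rexpZ//.
congr (fine (expectation P _)); apply/funext => w.
by rewrite !componentE; ring.
Qed.

Lemma innerDr X Y Z : L2 P X -> L2 P Y -> L2 P Z ->
  inner P Z (X + Y) = inner P Z X + inner P Z Y.
Proof.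
move=> LX LY LZ; rewrite inner_conj//; last exact: L2D.
by rewrite innerDl// (inner_conj LZ LX) (inner_conj LZ LY) rmorphD.
Qed.

Lemma innerZr a X Y : L2 P X -> L2 P Y ->
  inner P X (a *: Y) = Num.conj a * inner P X Y.
Proof.
move=> LX LY; rewrite inner_conj//; last exact: L2Z.
by rewrite innerZl// (inner_conj LX LY) rmorphM.
Qed.

Lemma innerBl X Y Z : L2 P X -> L2 P Y -> L2 P Z ->
  inner P (X - Y) Z = inner P X Z - inner P Y Z.
Proof.
move=> LX LY LZ; rewrite -scaleN1r innerDl ?innerZl ?mulN1r//; exact: L2Z.
Qed.

Lemma innerBr X Y Z : L2 P X -> L2 P Y -> L2 P Z ->
  inner P Z (X - Y) = inner P Z X - inner P Z Y.
Proof.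
move=> LX LY LZ; rewrite -scaleN1r innerDr ?innerZr ?rmorphN1 ?mulN1r//.
exact: L2Z.
Qed.

(** All estimates below are on squared norms, so that no square root is ever
taken. *)
Definition sqnorm X : R := fine (mean_square P X).

Lemma sqnorm_ge0 X : 0 <= sqnorm X.
Proof. by rewrite fine_ge0// expectation_ge0// => w; exact: sqmod_ge0. Qed.

Lemma mean_square_sqnorm X : L2 P X -> mean_square P X = (sqnorm X)%:E.
Proof.
move=> [_ _ X2]; rewrite fineK// ge0_fin_numE//.
by apply: expectation_ge0 => w; exact: sqmod_ge0.
Qed.

Lemma inner_sqnorm X : inner P X X = Complex (sqnorm X) 0.
Proof.
apply: complex_ext => /=.
  congr (fine (expectation P _)); apply/funext => w.
  by rewrite !componentE /sqmod; ring.
rewrite (_ : (fun w => _) = cst 0) ?expectation_cst//.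
by apply/funext => w; rewrite !componentE /=; ring.
Qed.

Lemma sqnorm_inner X : sqnorm X = complex.Re (inner P X X).
Proof. by rewrite inner_sqnorm. Qed.

Lemma sqnormZ a X : L2 P X -> sqnorm (a *: X) = sqmod a * sqnorm X.
Proof.
move=> LX; rewrite !sqnorm_inner innerZl// ?innerZr//; last exact: L2Z.
by rewrite inner_sqnorm !componentE /sqmod/=; ring.
Qed.

Lemma parallelogram X Y : L2 P X -> L2 P Y ->
  sqnorm (X + Y) + sqnorm (X - Y) = 2 * (sqnorm X + sqnorm Y).
Proof.
move=> LX LY; rewrite !sqnorm_inner.
rewrite innerDl ?innerBl//; [|exact: L2B|exact: L2D].
by rewrite (innerBr LX LY LX) (innerBr LX LY LY) !innerDr// !componentE; ring.
Qed.

Lemma sqnormD_le X Y : L2 P X -> L2 P Y ->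
  sqnorm (X + Y) <= 2 * (sqnorm X + sqnorm Y).
Proof. by move=> LX LY; rewrite -parallelogram// lerDl sqnorm_ge0. Qed.

(** The coefficient [inner P X Y] aligns the phase of the subtracted multiple of
[Y] with [X]: the cross term becomes real and the squared distance is a real
quadratic polynomial in [s]. *)
Lemma sqnormB_line X Y s : L2 P X -> L2 P Y ->
  sqnorm (X - (Complex s 0 * inner P X Y) *: Y) =
  sqnorm X - sqmod (inner P X Y) * (2 * s - s ^+ 2 * sqnorm Y).
Proof.
move=> LX LY; set a := _ * _; rewrite sqnorm_inner.
have LZ : L2 P (a *: Y) by exact: L2Z.
rewrite (innerBl LX LZ (L2B LX LZ)) (innerBr LX LZ LX) (innerBr LX LZ LZ).
rewrite !innerZl// !innerZr//.
rewrite (inner_conj LY LX) !inner_sqnorm {}/a in LZ *.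
by move: (inner P X Y) => c; rewrite /sqmod !componentE /=; ring.
Qed.

(** If no multiple of [Y] brings [X] closer to 0 by more than [e], then [X] is
nearly orthogonal to [Y]: move along the line of [sqnormB_line]. For [e = 0] it
is the orthogonality of a nearest point, and for [e = sqnorm X] the hypothesis
always holds, which gives a form of the Cauchy-Schwarz inequality. *)
Lemma almost_nearest_almost_orthogonal X Y e : L2 P X -> L2 P Y ->
  (forall a, sqnorm X <= sqnorm (X - a *: Y) + e) ->
  sqmod (inner P X Y) <= (1 + sqnorm Y) * e.
Proof.
move=> LX LY H; have n0 := sqnorm_ge0 Y.
have p0 : 0 < 1 + sqnorm Y by rewrite ltr_pwDl.
(* The optimal [s] is the inverse of [sqnorm Y]; adding 1 keeps it finite when
   [Y] vanishes almost surely, at the price of a factor in the bound. *)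
have := H (Complex (1 + sqnorm Y)^-1 0 * inner P X Y).
rewrite sqnormB_line//.
move: (sqmod _) (sqmod_ge0 (inner P X Y)) => c c0.
move: (sqnorm X) (sqnorm Y) n0 p0 => x y y0 p0 {}H.
rewrite -subr_ge0 (_ : _ - c = (1 + y) * (x - c * (2 * (1 + y)^-1 -
   (1 + y)^-1 ^+ 2 * y) + e - x) + c / (1 + y)); last by field; rewrite gt_eqF.
by rewrite addr_ge0 ?mulr_ge0 ?subr_ge0 ?invr_ge0// ltW.
Qed.

(** The constant is not optimal, but the bound suffices for the continuity of
[inner P ^~ Y]. *)
Lemma weak_cauchy_schwarz X Y : L2 P X -> L2 P Y ->
  sqmod (inner P X Y) <= (1 + sqnorm Y) * sqnorm X.
Proof.
move=> LX LY; apply: almost_nearest_almost_orthogonal => // a.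
by rewrite lerDr sqnorm_ge0.
Qed.

Lemma sqnorm_eq0 X : L2 P X -> sqnorm X = 0 -> {ae P, forall w, X w = 0}.
Proof.
move=> LX; have [mr mi _] := LX => X0.
have := mean_square_sqnorm LX; rewrite X0 /mean_square unlock => I0.
have mS : measurable_fun setT (fun w => (sqmod (X w))%:E).
  by apply/measurable_EFinP; apply: measurable_funD; exact: measurable_funX.
have /(ae_eq_integral_abs _ measurableT mS) :
    (\int[P]_w `|(sqmod (X w))%:E| = 0)%E.
  rewrite -[RHS]/(0%:E) -I0; apply: eq_integral => w _.
  by rewrite gee0_abs ?lee_fin ?sqmod_ge0.
by apply: filterS => w /(_ I) [] /sqmod_eq0.
Qed.

Lemma inner_ae_l X X' Y : L2 P X -> L2 P X' -> L2 P Y ->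
  {ae P, forall w, X w = X' w} -> inner P X Y = inner P X' Y.
Proof.
move=> LX LX' LY XX'.
have [r1 i1] := inner_Lfun1 LX LY; have [r2 i2] := inner_Lfun1 LX' LY.
have mE f : f \in Lfun P 1 -> measurable_fun setT (EFin \o f).
  by move=> /Lfun1_integrable /integrableP[].
rewrite /inner /cexpectation unlock; congr (Complex (fine _) (fine _));
  apply: ae_eq_integral => //; try exact: mE; by apply: filterS XX' => w -> _.
Qed.

(** The real completeness result applies to the real and to the imaginary parts;
the two errors add up, whence the factor 2. *)
Lemma L2_complete (f : nat -> T -> R[i]) : (forall n, L2 P (f n)) ->
  (forall n m, (n <= m)%N -> sqnorm (f m - f n) <= 4^-1 ^+ n) ->
  exists2 g, L2 P g & forall n, sqnorm (g - f n) <= 2 * 4^-1 ^+ n.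
Proof.
move=> Lf Hf.
have mR n : measurable_fun setT (RE (f n)) by have [] := Lf n.
have mI n : measurable_fun setT (IM (f n)) by have [] := Lf n.
have BE n m : (n <= m)%N ->
    ('E_P[fun w => ((complex.Re (f m w) - complex.Re (f n w)) ^+ 2)%R] +
     'E_P[fun w => ((complex.Im (f m w) - complex.Im (f n w)) ^+ 2)%R] <=
     (4^-1 ^+ n)%:E)%E.
  move=> /Hf; have LB := L2B (Lf m) (Lf n).
  rewrite -lee_fin -mean_square_sqnorm//; have [mr mi _] := LB.
  rewrite mean_squareE//; apply: le_trans.
  rewrite le_eqVlt; apply/orP; left; apply/eqP.
  by congr (expectation P _ + expectation P _)%E; apply/funext => w;
    rewrite !componentE.
have e0 h : (0 <= 'E_P[fun w => (h w ^+ 2)%R])%E.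
  by apply: expectation_ge0 => w; exact: sqr_ge0.
have [|g1 [mg1 Hg1]] := fast_cauchy_real_L2 mR (P := P).
  by move=> n m nm; apply: le_trans (BE _ _ nm); rewrite leeDl.
have [|g2 [mg2 Hg2]] := fast_cauchy_real_L2 mI (P := P).
  by move=> n m nm; apply: le_trans (BE _ _ nm); rewrite leeDr.
pose g w := Complex (g1 w) (g2 w).
have Lgf n : L2 P (g - f n) /\
    (mean_square P (g - f n)%R <= (2 * 4^-1 ^+ n)%:E)%E.
  have mr : measurable_fun setT (RE (g - f n)).
    rewrite (_ : RE _ = g1 \- RE (f n)); first exact: measurable_funB.
    by apply/funext => w; rewrite !componentE.
  have mi : measurable_fun setT (IM (g - f n)).
    rewrite (_ : IM _ = g2 \- IM (f n)); first exact: measurable_funB.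
    by apply/funext => w; rewrite !componentE.
  have ms : (mean_square P (g - f n)%R <= (2 * 4^-1 ^+ n)%:E)%E.
    rewrite mean_squareE// mulr_natl mulr2n EFinD.
    apply: le_trans (leeD (Hg1 n) (Hg2 n)).
    rewrite le_eqVlt; apply/orP; left; apply/eqP.
    by congr (expectation P _ + expectation P _)%E; apply/funext => w;
      rewrite !componentE.
  by split => //; split => //; apply: le_lt_trans ms _; rewrite ltry.
exists g.
  by rewrite -(subrK (f 0%N) g); apply: L2D => //; exact: (Lgf _).1.
by move=> n; have [LB] := Lgf n; rewrite mean_square_sqnorm.
Qed.

Lemma inner0l V : L2 P V -> inner P 0 V = 0.
Proof.
move=> LV; rewrite -[X in inner P X _](scale0r 0) innerZl ?mul0r//.
exact: L2_0.
Qed.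

Lemma sqnorm0 : sqnorm 0 = 0.
Proof. by rewrite sqnorm_inner inner0l//; exact: L2_0. Qed.

(** * Orthogonal projections *)

(** [sqnorm] is only a seminorm on functions, so that [subspace_closed] also makes
a closed subspace saturated for almost sure equality. *)
Record closed_subspace L : Prop := ClosedSubspace {
  subspace_L2 : L `<=` L2 P;
  subspace0 : L 0;
  subspaceD : forall X Y, L X -> L Y -> L (X + Y);
  subspaceZ : forall a X, L X -> L (a *: X);
  subspace_closed : forall X, L2 P X ->
    (forall e : R, 0 < e -> exists2 Z, L Z & sqnorm (X - Z) < e) -> L X }.

Lemma subspaceB L X Y : closed_subspace L -> L X -> L Y -> L (X - Y).
Proof.
by move=> cL LX LY; rewrite -scaleN1r; apply: subspaceD => //; exact: subspaceZ.
Qed.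

Lemma eq0_of_geometric (x C : R) : 0 <= x ->
  (forall n, x <= C * 4^-1 ^+ n) -> x = 0.
Proof.
move=> x0 H; apply/eqP; rewrite eq_le x0 andbT.
have : (fun n => C * 4^-1 ^+ n) @ \oo --> C * 0.
  by apply: cvgMr; apply: cvg_expr; rewrite ger0_norm; lra.
rewrite mulr0 => c0; rewrite -(cvg_lim _ c0)//.
by apply: limr_ge; [apply/cvg_ex; exists 0|exact: nearW].
Qed.

(** Let [delta] be the infimum of the squared distances from [X] to [L]. By the
parallelogram law, points of [L] whose squared distance to [X] is close to
[delta] are close to one another, since their midpoint is in [L]; hence a fast
minimizing sequence [z] converges to some [Z] in [L]. Each [X - z n] is almost
orthogonal to [L], and orthogonality of [X - Z] follows in the limit. *)
Lemma projection_theorem L X : closed_subspace L -> L2 P X ->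
  exists Z, is_projection P L X Z.
Proof.
move=> cL LX.
pose D := [set sqnorm (X - Z) | Z in L].
have Dinf : has_inf D.
  split; first by exists (sqnorm (X - 0)), 0 => //; exact: subspace0.
  by exists 0 => _ [Z _ <-]; exact: sqnorm_ge0.
pose delta := inf D.
have ledelta Z : L Z -> delta <= sqnorm (X - Z).
  by move=> LZ; apply: ge_inf; [exact: Dinf.2|exists Z].
(* The factor 1/4 absorbs the one that the parallelogram law produces. *)
pose eps n : R := 4^-1 * 4^-1 ^+ n.
have eps0 n : 0 < eps n by rewrite mulr_gt0 ?exprn_gt0 ?invr_gt0.
have /choice[z Hz] n : exists Z, L Z /\ sqnorm (X - Z) < delta + eps n.
  by have [_ [Z LZ <-] lt] := inf_adherent (eps0 n) Dinf; exists Z.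
have Lz n : L (z n) by have [] := Hz n.
have L2z n : L2 P (z n) by exact: subspace_L2 (Lz n).
have zC n m : (n <= m)%N -> sqnorm (z m - z n) <= 4^-1 ^+ n.
  move=> nm.
  have := parallelogram (L2B LX (L2z n)) (L2B LX (L2z m)).
  rewrite (_ : X - z n - (X - z m) = z m - z n); last first.
    by rewrite opprB addrC addrA subrK.
  have -> : X - z n + (X - z m) =
      Complex 2 0 *: (X - Complex 2^-1 0 *: (z n + z m)).
    rewrite scalerBr scalerA (_ : Complex 2 0 * _ = 1); last first.
      by apply: complex_ext; rewrite !componentE /=; field.
    rewrite scale1r (_ : Complex 2 0 = 1 + 1); last first.
      by apply: complex_ext; rewrite !componentE /=; ring.
    by rewrite scalerDl scale1r addrACA opprD.
  have Lmid : L (Complex 2^-1 0 *: (z n + z m)).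
    by apply: subspaceZ => //; exact: subspaceD.
  rewrite sqnormZ; last by apply: L2B => //; exact: subspace_L2 Lmid.
  have := ledelta _ Lmid; have [_] := Hz n; have [_] := Hz m.
  have : eps m <= eps n by rewrite ler_pM2l ?invr_gt0// ler_wiXn2l//; lra.
  by rewrite /sqmod/= /eps; lra.
have [Z LZ zZ] := L2_complete L2z zC.
have {}LLZ : L Z.
  apply: subspace_closed => // e e0.
  have [n ne] : exists n, 2 * 4^-1 ^+ n < e.
    apply: contrapT => /forallNP H; move: (e0).
    rewrite (@eq0_of_geometric e 2) ?ltxx//; first exact: ltW.
    by move=> n; rewrite leNgt; apply/negP/H.
  by exists (z n) => //; exact: le_lt_trans (zZ n) ne.
exists Z; split => // W LW.
have L2W : L2 P W by exact: subspace_L2 LW.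
(* 9/2 = 2 * (1/4 + 2): twice the sum of the errors of [eps] and of
   [L2_complete]. *)
apply: sqmod_eq0; apply: (@eq0_of_geometric _ (9 / 2 * (1 + sqnorm W))).
  exact: sqmod_ge0.
move=> n; rewrite -[X \- Z]/(X - Z).
rewrite (_ : X - Z = (X - z n) + (- 1) *: (Z - z n)); last first.
  by rewrite scaleN1r opprB addrA subrK.
have L2Xz : L2 P (X - z n) by exact: L2B.
have L2Zz : L2 P (Z - z n) by exact: L2B.
rewrite innerDl//; last exact: L2Z.
apply: le_trans (sqmodD_le _ _) _.
rewrite innerZl// sqmodM.
have h1 : sqmod (inner P (X - z n) W) <= (1 + sqnorm W) * eps n.
  apply: almost_nearest_almost_orthogonal => // a.
  have [_ /ltW/le_trans-> //] := Hz n.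
  rewrite lerD2r -addrA -opprD; apply: ledelta.
  by apply: subspaceD => //; exact: subspaceZ.
have h2 := weak_cauchy_schwarz L2Zz L2W.
have h3 : (1 + sqnorm W) * sqnorm (Z - z n) <= (1 + sqnorm W) * (2 * 4^-1 ^+ n).
  by apply: ler_wpM2l (zZ n); rewrite addr_ge0// sqnorm_ge0.
have -> : sqmod (-1 : R[i]) = 1 by rewrite /sqmod !componentE/=; ring.
by move: h1 h2 h3; rewrite /eps; lra.
Qed.

Lemma orth_projP L X : closed_subspace L -> L2 P X ->
  is_projection P L X (orth_proj P L X).
Proof.
by move=> cL LX; apply: xgetPex; exact: projection_theorem.
Qed.

(** The difference of two projections lies in [L] and is orthogonal to [L], hence
to itself. *)
Lemma projection_ae_unique L X Z Z' : closed_subspace L -> L2 P X ->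
  is_projection P L X Z -> is_projection P L X Z' ->
  {ae P, forall w, Z w = Z' w}.
Proof.
move=> cL LX [LZ oZ] [LZ' oZ'].
have LZZ := subspaceB cL LZ' LZ.
have [L2Z L2Z'] : L2 P Z /\ L2 P Z' by split; exact: subspace_L2 cL _ _.
have L2ZZ : L2 P (Z' - Z) by exact: L2B.
have : sqnorm (Z' - Z) = 0.
  have eZ : Z' - Z = X - Z - (X - Z') by rewrite [RHS]addrC opprB addrA subrK.
  rewrite sqnorm_inner {1}eZ (innerBl (L2B LX L2Z) (L2B LX L2Z') L2ZZ).
  rewrite (oZ _ LZZ : inner P (X - Z) _ = 0).
  by rewrite (oZ' _ LZZ : inner P (X - Z') _ = 0) subr0.
move=> /(sqnorm_eq0 L2ZZ); apply: filterS => w /eqP.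
by rewrite subr_eq0 => /eqP.
Qed.

(** * Closed spans *)

Lemma linear_span_ind G K : G `<=` K -> K 0 ->
  (forall X Y, K X -> K Y -> K (X + Y)) -> (forall a X, K X -> K (a *: X)) ->
  linear_span G `<=` K.
Proof.
move=> GK K0 KD KZ _ [n [c [f [Gf ->]]]].
rewrite (_ : (fun w => _) = \sum_(i < n) c i *: f i); last first.
  by apply/funext => w; rewrite fct_sumE.
by elim/big_ind: _ => // i _; apply/KZ/GK.
Qed.

Lemma linear_span_gen G : G `<=` linear_span G.
Proof.
move=> X GX; exists 1%N, (fun=> 1), (fun=> X); split => //.
by apply/funext => w; rewrite big_ord1 mul1r.
Qed.

Lemma linear_span0 G : linear_span G 0.
Proof.
exists 0%N, (fun=> 0), (fun=> 0); split; first by case.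
by apply/funext => w; rewrite big_ord0.
Qed.

Lemma linear_spanZ G a X : linear_span G X -> linear_span G (a *: X).
Proof.
move=> [n [c [f [Gf ->]]]]; exists n, (fun i => a * c i), f; split => //.
apply/funext => w; rewrite -[LHS]/(a * \sum_(i < n) c i * f i w) mulr_sumr.
by apply: eq_bigr => i _; rewrite mulrA.
Qed.

Lemma linear_spanD G X Y :
  linear_span G X -> linear_span G Y -> linear_span G (X + Y).
Proof.
move=> [n [c [f [Gf ->]]]] [m [c' [f' [Gf' ->]]]].
exists (n + m)%N,
  (fun i => match fintype.split i with inl j => c j | inr j => c' j end),
  (fun i => match fintype.split i with inl j => f j | inr j => f' j end); split.
  by move=> i; case: (fintype.split i).
apply/funext => w; rewrite big_split_ord/=; congr (_ + _);
  apply: eq_bigr => i _.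
  by rewrite -/(unsplit (inl i)) unsplitK.
by rewrite -/(unsplit (inr i)) unsplitK.
Qed.

Lemma linear_span_L2 G : G `<=` L2 P -> linear_span G `<=` L2 P.
Proof.
move=> GL; apply: linear_span_ind => //; [exact: L2_0|exact: L2D|exact: L2Z].
Qed.

Lemma closed_spanP G X : G `<=` L2 P ->
  closed_span P G X <-> L2 P X /\ forall e : R, 0 < e ->
    exists2 Z, linear_span G Z & sqnorm (X - Z) < e.
Proof.
move=> /linear_span_L2 GL; split=> -[LX H]; split => // e /H[Z GZ XZ];
  exists Z => //; move: XZ; rewrite -[X \- Z]/(X - Z) mean_square_sqnorm//;
  by apply: L2B => //; exact: GL.
Qed.

Lemma closed_span_gen G : G `<=` L2 P -> G `<=` closed_span P G.
Proof.
move=> GL X GX; apply/closed_spanP => //; split; first exact: GL.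
move=> e e0; exists X; first exact: linear_span_gen.
by rewrite subrr sqnorm0.
Qed.

Lemma closed_span_subspace G : G `<=` L2 P -> closed_subspace (closed_span P G).
Proof.
move=> GL; have SL := linear_span_L2 GL; split.
- by move=> X [].
- apply/closed_spanP => //; split; first exact: L2_0.
  move=> e e0; exists 0; first exact: linear_span0.
  by rewrite subrr sqnorm0.
- move=> X Y /(closed_spanP _ GL)[LX GX] /(closed_spanP _ GL)[LY GY].
  apply/closed_spanP => //; split; first exact: L2D.
  move=> e e0; have e4 : 0 < e / 4 by rewrite divr_gt0.
  have [Z SZ XZ] := GX _ e4; have [Z' SZ' YZ'] := GY _ e4.
  exists (Z + Z'); first exact: linear_spanD.
  rewrite opprD addrACA; apply: le_lt_trans (sqnormD_le _ _) _.
  + by apply: L2B => //; exact: SL.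
  + by apply: L2B => //; exact: SL.
  + by move: XZ YZ'; lra.
- move=> a X /(closed_spanP _ GL)[LX GX].
  apply/closed_spanP => //; split; first exact: L2Z.
  have p0 : 0 < 1 + sqmod a by rewrite ltr_pwDl ?sqmod_ge0.
  move=> e e0; have [Z SZ XZ] := GX _ (divr_gt0 e0 p0).
  exists (a *: Z); first exact: linear_spanZ.
  rewrite -scalerBr sqnormZ; last by apply: L2B => //; exact: SL.
  move: XZ; rewrite ltr_pdivlMr// mulrC; apply: le_lt_trans.
  by rewrite ler_wpM2r ?sqnorm_ge0// lerDr.
- move=> X LX HX; apply/closed_spanP => //; split => // e e0.
  have e4 : 0 < e / 4 by rewrite divr_gt0.
  have [Y /(closed_spanP _ GL)[LY GY] XY] := HX _ e4.
  have [Z SZ YZ] := GY _ e4; exists Z => //.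
  rewrite -(subrK Y X) -addrA; apply: le_lt_trans (sqnormD_le _ _) _.
  + exact: L2B.
  + by apply: L2B => //; exact: SL.
  + by move: XY YZ; lra.
Qed.

Lemma sub_closed_span G G' : G `<=` G' -> closed_span P G `<=` closed_span P G'.
Proof.
move=> GG' X [LX H]; split => // e /H[Z [n [c [f [Gf ->]]]] XZ].
by eexists; [|exact: XZ]; exists n, c, f; split => // i; exact: GG'.
Qed.

(** The variables orthogonal to [V] form a linear space, and
[weak_cauchy_schwarz] lets orthogonality pass to the limit. *)
Lemma orthogonal_closed_span G V : G `<=` L2 P -> L2 P V ->
  (forall X, G X -> inner P X V = 0) ->
  forall X, closed_span P G X -> inner P X V = 0.
Proof.
move=> GL LV oG X /(closed_spanP _ GL)[LX GX].
pose K := [set Z | L2 P Z /\ inner P Z V = 0].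
have SK : linear_span G `<=` K.
  apply: linear_span_ind => [Z GZ||Z W [LZ Z0] [LW W0]|a Z [LZ Z0]]; split.
  - exact: GL.
  - exact: oG.
  - exact: L2_0.
  - exact: inner0l.
  - exact: L2D.
  - by rewrite innerDl// Z0 W0 addr0.
  - exact: L2Z.
  - by rewrite innerZl// Z0 mulr0.
have p0 : 0 < 1 + sqnorm V by rewrite ltr_pwDl ?sqnorm_ge0.
apply: sqmod_eq0; apply/eqP; rewrite eq_le sqmod_ge0 andbT.
apply/ler_addgt0Pl => e e0; rewrite addr0.
have [Z /SK[LZ Z0] XZ] := GX _ (divr_gt0 e0 p0).
rewrite -[inner P X V]subr0 -Z0 -innerBl//.
apply: le_trans (weak_cauchy_schwarz (L2B LX LZ) LV) _.
by rewrite mulrC -ler_pdivlMr// ltW.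
Qed.

(** * Conditional orthogonality and projections *)

Lemma orthogonal_sym X Y : L2 P X -> L2 P Y ->
  inner P X Y = 0 -> inner P Y X = 0.
Proof. by move=> LX LY XY; rewrite inner_conj// XY rmorph0. Qed.

(** Call [X - orth_proj P LC X] the residual of [X]; it is always orthogonal to
[LC]. Hence its inner product with the residual of [W] is its inner product with
[W], and the left side says that the residuals of [LB] are orthogonal to [LA],
equivalently to [LS], which [GA] and [GC] generate. A residual orthogonal to
[LS] means that the projection onto [LC] already is the one onto [LS]. The
passage from generators to the closed spans [LB] and [LS] works because
orthogonality to a fixed variable is a closed linear condition. *)
Theorem cond_orthogonal_closed_spanP GA GB GC :
  GA `<=` L2 P -> GB `<=` L2 P -> GC `<=` L2 P ->
  let LA := closed_span P GA in let LB := closed_span P GB in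
  let LC := closed_span P GC in let LS := closed_span P (GA `|` GC) in
  cond_orthogonal P LB LA LC <->
  forall X, GB X -> {ae P, forall w, orth_proj P LS X w = orth_proj P LC X w}.
Proof.
move=> GAL GBL GCL LA LB LC LS.
have GSL : GA `|` GC `<=` L2 P by move=> X [/GAL|/GCL].
have cA : closed_subspace LA by exact: closed_span_subspace.
have cB : closed_subspace LB by exact: closed_span_subspace.
have cC : closed_subspace LC by exact: closed_span_subspace.
have cS : closed_subspace LS by exact: closed_span_subspace.
have LAS : LA `<=` LS by apply: sub_closed_span => X; left.
have LCS : LC `<=` LS by apply: sub_closed_span => X; right.
have pC X : L2 P X -> is_projection P LC X (orth_proj P LC X).
  exact: orth_projP.
have L2pC X : L2 P X -> L2 P (orth_proj P LC X).
  by move=> /pC[/(subspace_L2 cC)].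
have L2rC X : L2 P X -> L2 P (X - orth_proj P LC X).
  by move=> LX; apply: L2B => //; exact: L2pC.
have rC X W : L2 P X -> LC W -> inner P (X - orth_proj P LC X) W = 0.
  by move=> /pC[_]; apply.
split=> [co X BX|ae_eq X W BX AW].
- have LX := GBL _ BX; have L2r := L2rC _ LX.
  apply: (projection_ae_unique cS LX); first exact: orth_projP.
  split; first by apply: LCS; have [] := pC _ LX.
  move=> W SW; apply: orthogonal_sym; [exact: subspace_L2 cS _ SW|exact: L2r|].
  (* On a generator from [GA], replace [W] by its residual: this keeps the inner
     product because the residual of [X] is orthogonal to [LC]. *)
  apply: (orthogonal_closed_span GSL L2r _ SW) => {SW}W [AW|CW]; last first.
    apply: orthogonal_sym => //; first exact: GCL.
    by apply: rC => //; exact: closed_span_gen.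
  have LW := GAL _ AW.
  apply: orthogonal_sym => //; rewrite -(subrK (orth_proj P LC W) W).
  rewrite innerDr//; [|exact: L2rC|exact: L2pC].
  rewrite (rC _ _ LX (pC _ LW).1) addr0.
  by apply: co; exact: closed_span_gen.
- have LX := subspace_L2 cB BX; have LW := subspace_L2 cA AW.
  have L2V := L2rC _ LW.
  rewrite -[X \- _]/(X - _) -[W \- _]/(W - _).
  have SV : LS (W - orth_proj P LC W).
    exact: (subspaceB cS (LAS _ AW) (LCS _ (pC _ LW).1)).
  have oV U : LC U -> inner P U (W - orth_proj P LC W) = 0.
    move=> CU; apply: orthogonal_sym => //; first exact: subspace_L2 cC _ CU.
    exact: rC.
  move: (W - _) L2V SV oV => V L2V SV oV.
  (* [V], the residual of [W], lies in [LS] and is orthogonal to [LC]. Hence [X]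
     may stand for its residual, and the goal is linear and closed in [X]. *)
  rewrite (innerBl LX (L2pC _ LX) L2V) (oV _ (pC _ LX).1) subr0.
  apply: (orthogonal_closed_span GBL L2V _ BX) => {LX BX}X BX.
  have LX := GBL _ BX; have [SpX oX] := orth_projP cS LX.
  rewrite -(subrK (orth_proj P LC X) X) (innerDl (L2rC _ LX) (L2pC _ LX) L2V).
  rewrite (oV _ (pC _ LX).1) addr0 -(oX _ SV).
  apply: inner_ae_l => //; first exact: L2rC.
    by apply: L2B => //; exact: subspace_L2 cS _ SpX.
  by apply: filterS (ae_eq _ BX) => w /= e; rewrite /GRing.add/GRing.opp/= e.
Qed.
End Hilbert.

Theorem theorem3p5 (d : measure_display) (T : measurableType d) (R : realType)
    (P : probability T R) (k : nat) (Y : process T R k)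
    (Ystat : weakly_stationary P Y) (Ycent : centered P Y)
    (Ycont : mean_square_continuous P Y)
    (A B S : {set 'I_k}) (sAS : A \subset S) (sBS : B \subset S)
    (dAB : (A :&: B)%SET = finset.set0) :
  granger_noncausal P Y A B S <->
  forall (h t : R) (b : 'I_k), 0 <= h <= 1 -> b \in B ->
    {ae P, forall w, orth_proj P (past_space P Y S t) (Y b (t + h)) w =
                     orth_proj P (past_space P Y (S :\: A)%SET t) (Y b (t + h)) w}.
Proof.
have [LY _ _] := Ystat.
pose gen (C : {set 'I_k}) (s t : \bar R) :=
  [set X | exists a u, [/\ a \in C, (s <= u%:E <= t)%E & X = Y a u]].
have LG C s t : gen C s t `<=` L2 P by move=> _ [a [u [_ _ ->]]]; exact: LY.
have pastS t : past_space P Y S t =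
    closed_span P (gen A -oo%E t%:E `|` gen (S :\: A)%SET -oo%E t%:E).
  rewrite /past_space /process_space; congr closed_span; apply/seteqP; split.
  - move=> _ [a [u [aS ut ->]]]; have [aA|aA] := boolP (a \in A).
      by left; exists a, u.
    by right; exists a, u; split => //; rewrite !inE aA.
  - move=> _ [|] [a [u [aA ut ->]]]; exists a, u; split => //.
      exact: (fintype.subsetP sAS _ aA).
    by move: aA; rewrite inE => /andP[].
have ncP t := cond_orthogonal_closed_spanP (LG A -oo%E t%:E)
  (LG B t%:E (t + 1)%:E) (LG (S :\: A)%SET -oo%E t%:E).
split=> [nc h t b /andP[h0 h1] bB|H t].
  rewrite pastS; apply: (ncP t).1; first exact: nc.
  by exists b, (t + h); rewrite !lee_fin lerDl lerD2l h0 h1.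
apply/(ncP t) => _ [b [u [bB /andP[tu ut] ->]]].
move: tu ut; rewrite !lee_fin => tu ut; rewrite -pastS -(subrKC t u).
by apply: H => //; rewrite subr_ge0 tu/= lerBlDl.
Qed.
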